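(* Fix four positive masses $m_1,m_2,m_3,m_4>0$ in the Newtonian four-body problem. For each cyclic ordering of the four masses on a circle, there is at most one co-circular central configuration of the four bodies with that cyclic ordering, counted up to equivalence (two configurations $\mathbf{q},\mathbf{q}'$ being equivalent if $\mathbf{q}_i'=kR\mathbf{q}_i$ for all $i$, for some nonzero constant $k\in\mathbb{R}$ and some orthogonal matrix $R$).
   Context: Bodies with masses $m_i>0$ are at positions $\mathbf{q}_i\in\mathbb{R}^d$, $i=1,\dots,4$, with center of mass $\frac1M\sum m_i\mathbf{q}_i=0$, where $M=m_1+\dots+m_4$; $r_{ij}=\|\mathbf{q}_i-\mathbf{q}_j\|$. A central configuration is a configuration $\mathbf{q}$ (with distinct positions) for which there exists $\lambda\in\mathbb{R}$ with $\lambda m_i\mathbf{q}_i=\sum_{j\neq i}\frac{m_im_j(\mathbf{q}_j-\mathbf{q}_i)}{r_{ij}^3}$ for $i=1,\dots,4$. A configuration is co-circular if the four bodies lie on a common circle; the cyclic ordering is the order in which the masses appear around that circle. *)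

(* Defs.v *)
From mathcomp Require Import all_boot all_order all_algebra fingroup perm.
From mathcomp Require Import all_classical all_reals all_analysis.
Set Implicit Arguments. Unset Strict Implicit. Unset Printing Implicit Defensive.
Import Order.TTheory GRing.Theory Num.Theory.
Local Open Scope ring_scope.

Definition dotv (R : realType) (d : nat) (u v : 'cV[R]_d) : R := (u^T *m v) 0 0.
Definition normv (R : realType) (d : nat) (u : 'cV[R]_d) : R := Num.sqrt (dotv u u).

Definition rdist (R : realType) (d : nat) (q : 'I_4 -> 'cV[R]_d) (i j : 'I_4) : R :=
  normv (q i - q j).

Definition com_zero (R : realType) (d : nat) (m : 'I_4 -> R) (q : 'I_4 -> 'cV[R]_d) :=
  (\sum_(i < 4) m i)^-1 *: (\sum_(i < 4) m i *: q i) = 0.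

Definition central_config (R : realType) (d : nat) (m : 'I_4 -> R) (q : 'I_4 -> 'cV[R]_d) :=
  [/\ injective q, com_zero m q &
    exists lambda : R, forall i : 'I_4,
      lambda * m i *: q i =
      \sum_(j < 4 | j != i) ((m i * m j) / rdist q i j ^+ 3) *: (q j - q i)].

(* The four bodies lie on a common circle (centre c, radius rho > 0, in the plane
   spanned by orthonormal u, v), and they appear around it in the cyclic order
   s 0, s 1, s 2, s 3: there are angles strictly increasing along this order,
   within one full turn.  Since u, v may be chosen in either orientation, the
   cyclic ordering is taken up to rotation and reflection. *)
Definition cocircular_with_order (R : realType) (d : nat) (q : 'I_4 -> 'cV[R]_d)
    (s : {perm 'I_4}) :=
  exists (c u v : 'cV[R]_d) (rho : R) (theta : 'I_4 -> R),
    [/\ 0 < rho, dotv u u = 1, dotv v v = 1 & dotv u v = 0] /\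
    (forall i, q i = c + rho *: (cos (theta i) *: u + sin (theta i) *: v)) /\
        [/\ theta (s 0) < theta (s 1), theta (s 1) < theta (s 2),
            theta (s 2) < theta (s 3) & theta (s 3) < theta (s 0) + 2 * pi].

Definition cocircular (R : realType) (d : nat) (q : 'I_4 -> 'cV[R]_d) :=
  exists s : {perm 'I_4}, cocircular_with_order q s.

Definition orthogonal_mx (R : realType) (d : nat) (A : 'M[R]_d) := A^T *m A = 1%:M.

Definition equiv_config (R : realType) (d : nat) (q q' : 'I_4 -> 'cV[R]_d) :=
  exists (k : R) (A : 'M[R]_d),
    k != 0 /\ orthogonal_mx A /\ forall i, q' i = k *: (A *m q i).

(* Main.v *)
Require Import Defs.
From mathcomp Require Import all_boot all_order all_algebra fingroup perm.
From mathcomp Require Import all_classical all_reals all_analysis.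
From mathcomp Require Import ring lra.
Import Order.TTheory GRing.Theory Num.Theory.
Local Open Scope ring_scope.
Set Implicit Arguments. Unset Strict Implicit.

(** On a circle of radius [rho] the areas of the four triangles are products of
three distances over [4 rho], so Dziobek's equations become
  [m_i m_j (L r_ij^2 - 1 / r_ij) = -/+ mu r_ij r_kl]   ([-] sides, [+] diagonals),
which are the Lagrange equations of [U + L I] under the single Ptolemy constraint
[r_13 r_24 = r_12 r_34 + r_14 r_23]; Ptolemy also forces [mu > 0]. In the variables
[ln r_ij] the function is strictly convex, and the set
[r_13 r_24 >= r_12 r_34 + r_14 r_23] is convex by convexity of log-sum-exp; since the
multiplier has the right sign, a critical point is the unique minimum. After
rescaling so that [L] agrees, the six distances therefore coincide, and centred
configurations with equal distances differ by an orthogonal map. *)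

(** * Convexity inequalities and uniqueness of critical distances *)

Lemma sum_ord4 (V : nmodType) (F : 'I_4 -> V) :
  \sum_(i < 4) F i = F 0 + F 1 + F 2 + F 3.
Proof.
rewrite !big_ord_recl big_ord0 addr0 !addrA.
by congr (F _ + F _ + F _ + F _); apply: val_inj.
Qed.

Lemma forall_ord4 (P : 'I_4 -> Prop) : P 0 -> P 1 -> P 2 -> P 3 -> forall i, P i.
Proof.
move=> P0 P1 P2 P3 [[|[|[|[|i]]]] //= lti].
- by rewrite (_ : Ordinal lti = 0) //; apply: val_inj.
- by rewrite (_ : Ordinal lti = 1) //; apply: val_inj.
- by rewrite (_ : Ordinal lti = 2) //; apply: val_inj.
- by rewrite (_ : Ordinal lti = 3) //; apply: val_inj.
Qed.

(** Tangent-plane inequality for the convex function [ln (exp x + exp y)] at [(ln a', ln b')],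
    multiplied by [a' + b']. *)
Lemma log_sum_ineq (R : realType) (a b a' b' : R) :
  0 < a -> 0 < b -> 0 < a' -> 0 < b' ->
  (a' + b') * (ln (a' + b') - ln (a + b)) <=
  a' * (ln a' - ln a) + b' * (ln b' - ln b).
Proof.
move=> a0 b0 a'0 b'0.
have s0 : 0 < a + b by rewrite addr_gt0.
have s'0 : 0 < a' + b' by rewrite addr_gt0.
(* Each term is bounded through [ln z <= z - 1]; the two upper bounds, for [a, a'] and for [b, b'],
   add up to zero. *)
have key (x x' : R) : 0 < x -> 0 < x' ->
    x' * ((ln (a' + b') - ln (a + b)) - (ln x' - ln x)) <=
    x * ((a' + b') / (a + b)) - x'.
  move=> x0 x'0; set z := (a' + b') / (a + b) * (x / x').
  have z0 : 0 < z by rewrite !mulr_gt0 // invr_gt0.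
  have -> : ln (a' + b') - ln (a + b) - (ln x' - ln x) = ln z.
    rewrite /z lnM ?posrE ?divr_gt0 // !ln_div ?posrE //; ring.
  have -> : x * ((a' + b') / (a + b)) - x' = x' * (z - 1).
    by rewrite /z; field; rewrite !gt_eqF.
  rewrite ler_pM2l //.
  by have := @le_ln1Dx R (z - 1); rewrite (addrC 1) subrK; apply; lra.
have ka := key a a' a0 a'0; have kb := key b b' b0 b'0.
have e : a * ((a' + b') / (a + b)) - a' + (b * ((a' + b') / (a + b)) - b') = 0.
  by field; rewrite gt_eqF.
set Z := ln _ - ln _ in ka kb *.
by move: (lerD ka kb); rewrite e; lra.
Qed.

(** [L * y ^+ 2 - y^-1] is the derivative of [L * y ^+ 2 / 2 + y^-1] with respect to [ln y]. It is
    strictly increasing, which is the strict convexity in logarithmic variables. *)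
Lemma ln_mono_prod_ge0 (R : realType) (L x y : R) : 0 < L -> 0 < x -> 0 < y ->
  0 <= ((L * y ^+ 2 - y^-1) - (L * x ^+ 2 - x^-1)) * (ln y - ln x) ?= iff (x == y).
Proof.
move=> L0.
wlog xy : x y / x <= y.
  move=> H x0 y0; have [/H|/ltW/H] := leP x y; first exact.
  move=> /(_ y0 x0); rewrite eq_sym; congr (_ <= _ ?= iff _); ring.
move=> x0 y0; apply/leifP; case: eqVneq => [->|nxy]; first by rewrite !subrr mulr0.
have {}xy : x < y by rewrite lt_neqAle nxy.
apply: mulr_gt0; last by rewrite subr_gt0 ltr_ln ?posrE.
have xyV : y^-1 < x^-1 by rewrite ltf_pV2.
have : L * x ^+ 2 < L * y ^+ 2 by rewrite ltr_pM2l // ltrXn2r // ltW.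
lra.
Qed.

(* The right-hand sides are [-/+ mu] times the partial derivatives of the Ptolemy
   expression with respect to [ln r_ij]. *)
Record ptolemy_critical (R : realType) (w r : 'I_4 -> 'I_4 -> R) (L mu : R) : Prop :=
  PtolemyCritical {
  pc_pos : forall i j, i != j -> 0 < r i j;
  pc_mu : 0 <= mu;
  pc_ptolemy : r 0 2 * r 1 3 = r 0 1 * r 2 3 + r 0 3 * r 1 2;
  pc01 : w 0 1 * (L * r 0 1 ^+ 2 - (r 0 1)^-1) = - (mu * (r 0 1 * r 2 3));
  pc23 : w 2 3 * (L * r 2 3 ^+ 2 - (r 2 3)^-1) = - (mu * (r 0 1 * r 2 3));
  pc03 : w 0 3 * (L * r 0 3 ^+ 2 - (r 0 3)^-1) = - (mu * (r 0 3 * r 1 2));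
  pc12 : w 1 2 * (L * r 1 2 ^+ 2 - (r 1 2)^-1) = - (mu * (r 0 3 * r 1 2));
  pc02 : w 0 2 * (L * r 0 2 ^+ 2 - (r 0 2)^-1) = mu * (r 0 2 * r 1 3);
  pc13 : w 1 3 * (L * r 1 3 ^+ 2 - (r 1 3)^-1) = mu * (r 0 2 * r 1 3) }.

(** The sum pairs the gradient at [r] with the displacement from [ln r'] to [ln r]. The critical
    equations and both Ptolemy identities turn it into [mu] times the left side minus the right side
    of [log_sum_ineq], so the sign of [mu] decides. *)
Lemma ptolemy_critical_defect (R : realType) (w r r' : 'I_4 -> 'I_4 -> R) (L mu mu' : R) :
  ptolemy_critical w r L mu -> ptolemy_critical w r' L mu' ->
  let h i j := w i j * (L * r i j ^+ 2 - (r i j)^-1) * (ln (r i j) - ln (r' i j)) in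
  h 0 1 + h 2 3 + h 0 3 + h 1 2 + h 0 2 + h 1 3 <= 0.
Proof.
case=> rp mu0 pt e01 e23 e03 e12 e02 e13 [rp' mu0' pt' _ _ _ _ _ _] /=.
rewrite e01 e23 e03 e12 e02 e13.
have := @log_sum_ineq R (r' 0 1 * r' 2 3) (r' 0 3 * r' 1 2)
   (r 0 1 * r 2 3) (r 0 3 * r 1 2).
rewrite -pt -pt' !lnM ?posrE ?rp ?rp' // !mulr_gt0 ?rp ?rp' // => /(_ isT isT isT isT).
rewrite -subr_ge0 => /(mulr_ge0 mu0) H.
rewrite -oppr_ge0; move: H; congr (_ <= _); ring.
Qed.

(** Adding the defect inequalities for [(r, r')] and [(r', r)] gives a sum of six monotonicity terms
    that is at most zero. Each term is nonnegative, hence zero, and its equality case identifies the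
    distances. *)
Lemma ptolemy_critical_uniq (R : realType) (w r r' : 'I_4 -> 'I_4 -> R) (L mu mu' : R) :
  0 < L -> (forall i j, 0 < w i j) ->
  (forall i, r i i = r' i i) ->
  (forall i j, r i j = r j i) -> (forall i j, r' i j = r' j i) ->
  ptolemy_critical w r L mu -> ptolemy_critical w r' L mu' -> r =2 r'.
Proof.
move=> L0 w0 rd rs rs' cr cr'.
have := ptolemy_critical_defect cr cr'; have := ptolemy_critical_defect cr' cr.
move: (pc_pos cr) (pc_pos cr') => rp rp' /= D D'.
have mono i j : i != j -> 0 <=
     w i j * (L * r i j ^+ 2 - (r i j)^-1) * (ln (r i j) - ln (r' i j)) +
     w i j * (L * r' i j ^+ 2 - (r' i j)^-1) * (ln (r' i j) - ln (r i j))
     ?= iff (r' i j == r i j).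
  move=> ij; have [le e] := ln_mono_prod_ge0 L0 (rp' _ _ ij) (rp _ _ ij).
  have -> : forall W A B a b : R, W * A * (a - b) + W * B * (b - a) =
      W * ((A - B) * (a - b)) by move=> *; ring.
  split; first exact: mulr_ge0 (ltW (w0 i j)) le.
  by rewrite -e ![0 == _]eq_sym mulf_eq0 gt_eqF.
have [//|m01 e01] := mono 0 1; have [//|m23 e23] := mono 2 3.
have [//|m03 e03] := mono 0 3; have [//|m12 e12] := mono 1 2.
have [//|m02 e02] := mono 0 2; have [//|m13 e13] := mono 1 3.
have {}e01 : r' 0 1 = r 0 1 by apply/eqP; rewrite -e01; apply/eqP; lra.
have {}e23 : r' 2 3 = r 2 3 by apply/eqP; rewrite -e23; apply/eqP; lra.
have {}e03 : r' 0 3 = r 0 3 by apply/eqP; rewrite -e03; apply/eqP; lra.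
have {}e12 : r' 1 2 = r 1 2 by apply/eqP; rewrite -e12; apply/eqP; lra.
have {}e02 : r' 0 2 = r 0 2 by apply/eqP; rewrite -e02; apply/eqP; lra.
have {}e13 : r' 1 3 = r 1 3 by apply/eqP; rewrite -e13; apply/eqP; lra.
apply: forall_ord4; apply: forall_ord4 => //; rewrite rs rs'; symmetry => //.
Qed.

(** * Inner products, reflections and extension of isometries *)

Section DotProduct.
Context {R : realType} {d : nat}.
Implicit Types (u v x y : 'cV[R]_d) (A : 'M[R]_d).

Lemma dotvC u v : dotv u v = dotv v u.
Proof. by rewrite /dotv -[in LHS](trmxK v) -trmx_mul mxE. Qed.

Lemma dotvDr u x y : dotv u (x + y) = dotv u x + dotv u y.
Proof. by rewrite /dotv mulmxDr mxE. Qed.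

Lemma dotvZr a u x : dotv u (a *: x) = a * dotv u x.
Proof. by rewrite /dotv -scalemxAr mxE. Qed.

Lemma dotvDl u x y : dotv (x + y) u = dotv x u + dotv y u.
Proof. by rewrite !(dotvC _ u) dotvDr. Qed.

Lemma dotvZl a u x : dotv (a *: x) u = a * dotv x u.
Proof. by rewrite !(dotvC _ u) dotvZr. Qed.

Lemma dotvNr u x : dotv u (- x) = - dotv u x.
Proof. by rewrite -scaleN1r dotvZr mulN1r. Qed.

Lemma dotvNl u x : dotv (- x) u = - dotv x u.
Proof. by rewrite !(dotvC _ u) dotvNr. Qed.

Definition dotv_lin := (dotvDr, dotvDl, dotvNr, dotvNl, dotvZr, dotvZl).

Lemma dotv0r u : dotv u 0 = 0.
Proof. by rewrite -(scale0r 0) dotvZr mul0r. Qed.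

Lemma dotv_sumr u I (r : seq I) (P : pred I) (F : I -> 'cV[R]_d) :
  dotv u (\sum_(i <- r | P i) F i) = \sum_(i <- r | P i) dotv u (F i).
Proof. exact: (big_morph (dotv u) (dotvDr u) (dotv0r u)). Qed.

Lemma dotvv_ge0 u : 0 <= dotv u u.
Proof. by rewrite /dotv mxE; apply: sumr_ge0 => k _; rewrite !mxE -expr2 sqr_ge0. Qed.

Lemma dotvv_eq0 u : (dotv u u == 0) = (u == 0).
Proof.
apply/eqP/eqP => [|->]; last exact: dotv0r.
rewrite /dotv mxE => /eqP; rewrite psumr_eq0 => [/allP u0|k _]; last first.
  by rewrite !mxE -expr2 sqr_ge0.
apply/matrixP=> i j; rewrite ord1 [RHS]mxE; apply/eqP.
by have := u0 i (mem_index_enum _); rewrite !mxE /= mulf_eq0 orbb.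
Qed.

Lemma orthogonal_dotv A x y : orthogonal_mx A -> dotv (A *m x) (A *m y) = dotv x y.
Proof. by move=> oA; rewrite /dotv trmx_mul -mulmxA (mulmxA A^T) oA mul1mx. Qed.

Lemma orthogonal_mxM A B : orthogonal_mx A -> orthogonal_mx B -> orthogonal_mx (A *m B).
Proof.
by rewrite /orthogonal_mx trmx_mul => oA oB; rewrite -mulmxA (mulmxA A^T) oA mul1mx.
Qed.

Definition householder u : 'M[R]_d := 1%:M - (2 / dotv u u) *: (u *m u^T).

Lemma householderE u x : householder u *m x = x - (2 * dotv u x / dotv u u) *: u.
Proof.
rewrite mulmxBl mul1mx -scalemxAl -mulmxA [u^T *m x]mx11_scalar mul_mx_scalar.
by rewrite scalerA mulrAC.
Qed.

Lemma householder_orthogonal u : u != 0 -> orthogonal_mx (householder u).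
Proof.
rewrite -dotvv_eq0 => u0.
have hT : (householder u)^T = householder u.
  by rewrite /householder linearB linearZ /= trmx1 trmx_mul trmxK.
rewrite /orthogonal_mx hT {2}/householder mulmxBr mulmx1 -scalemxAr mulmxA.
rewrite householderE mulfK // mulmxBl -scalemxAl scaler_nat mulr2n opprD addNKr.
by rewrite scalerN opprK /householder subrK.
Qed.

(* Extend one vector at a time: the reflection exchanging [A x_n] and [y_n] fixes
   the [y_i] already reached, as equal Gram matrices make them orthogonal to
   [A x_n - y_n]. *)
Lemma isometry_extension n (x y : nat -> 'cV[R]_d) :
  (forall i j, (i < n)%N -> (j < n)%N -> dotv (x i) (x j) = dotv (y i) (y j)) ->
  exists2 A : 'M[R]_d, orthogonal_mx A & forall i, (i < n)%N -> A *m x i = y i.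
Proof.
elim: n => [|n IHn] xy.
  by exists 1%:M => //; rewrite /orthogonal_mx trmx1 mul1mx.
have [i j ltin ltjn|A oA Axy] := IHn; first by apply: xy; apply: ltnW.
have [Axn|Axn] := eqVneq (A *m x n) (y n).
  by exists A => // i; rewrite ltnS leq_eqVlt => /predU1P[-> //|]; apply: Axy.
set w := A *m x n - y n.
have w0 : w != 0 by rewrite subr_eq0.
exists (householder w *m A).
  by apply: orthogonal_mxM => //; apply: householder_orthogonal.
move=> i; rewrite ltnS leq_eqVlt -mulmxA householderE => /predU1P[->|ltin].
  have ww : 2 * dotv w (A *m x n) = dotv w w.
    rewrite /w !dotv_lin (dotvC (y n)) orthogonal_dotv // -(xy n n) //; ring.
  by rewrite ww divff ?dotvv_eq0 // scale1r /w opprB addrC subrK.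
rewrite Axy //; have -> : dotv w (y i) = 0.
  rewrite /w !dotv_lin -{1}Axy // orthogonal_dotv // xy ?subrr // ltnW //.
by rewrite mulr0 mul0r scale0r subr0.
Qed.

End DotProduct.

(** * Central configurations on a circle as Ptolemy-critical points *)

(** Since the centre of mass is at the origin, [M *: q i] is minus the sum of the
    [m j *: (q j - q i)]; the term in [lambda] is thus absorbed into the pairwise forces, with
    [L = - (lambda / M)]. *)
Lemma central_config_balance (R : realType) (d : nat) (m : 'I_4 -> R)
    (q : 'I_4 -> 'cV[R]_d) :
  (forall i, 0 < m i) -> central_config m q ->
  exists L : R, forall i,
    \sum_(j < 4) (m j * ((rdist q i j ^+ 3)^-1 - L)) *: (q j - q i) = 0.
Proof.
move=> m0 [_ com [lambda eqL]]; set M := \sum_(i < 4) m i.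
have M0 : M != 0 by rewrite gt_eqF // /M sum_ord4 !addr_gt0.
have {}com : \sum_(i < 4) m i *: q i = 0.
  by move/eqP: com; rewrite scaler_eq0 invr_eq0 (negPf M0) => /eqP.
exists (- (lambda / M)) => i.
have S_i : \sum_(j < 4) (m j / rdist q i j ^+ 3) *: (q j - q i) = lambda *: q i.
  apply: (scalerI (lt0r_neq0 (m0 i))).
  rewrite scalerA mulrC eqL scaler_sumr (bigD1 i) //= subrr !scaler0 add0r.
  by apply: eq_bigr => j _; rewrite scalerA mulrA.
have C_i : \sum_(j < 4) m j *: (q j - q i) = - (M *: q i).
  under eq_bigr do rewrite scalerBr.
  by rewrite sumrB com sub0r -scaler_suml.
transitivity (lambda *: q i + (lambda / M) *: - (M *: q i)); last first.
  by rewrite scalerN scalerA divfK // subrr.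
rewrite -S_i -C_i scaler_sumr -big_split /=; apply: eq_bigr => j _.
by rewrite scalerA -scalerDl opprK mulrDr (mulrC (m j) (lambda / M)).
Qed.

Section Circle.
Context {R : realType} {d : nat} (m : 'I_4 -> R) (q : 'I_4 -> 'cV[R]_d).
Context (c u v : 'cV[R]_d) (rho : R) (theta : 'I_4 -> R).
Hypothesis m_gt0 : forall i, 0 < m i.
Hypotheses (rho_gt0 : 0 < rho) (uu : dotv u u = 1) (vv : dotv v v = 1)
  (uv : dotv u v = 0).
Hypothesis qE : forall i, q i = c + rho *: (cos (theta i) *: u + sin (theta i) *: v).

(** Signed chord length divided by the diameter; keeping the sign makes it antisymmetric, and
    positive along the cyclic order. *)
Let hs i j := sin ((theta j - theta i) / 2).

Let hsN i j : hs j i = - hs i j.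
Proof. by rewrite /hs -sinN -mulNr opprB. Qed.

Let hs0 i : hs i i = 0.
Proof. by rewrite /hs subrr mul0r sin0. Qed.

Lemma rdist_circle i j : rdist q i j = 2 * rho * `|hs i j|.
Proof.
rewrite /rdist /normv.
have -> : dotv (q i - q j) (q i - q j) = (2 * rho * hs i j) ^+ 2.
  pose x := (theta j - theta i) / 2.
  have cE : cos (theta i) * cos (theta j) + sin (theta i) * sin (theta j) =
      cos x ^+ 2 - sin x ^+ 2.
    by rewrite mulrC (mulrC (sin _)) -cosB !expr2 -cosD; congr cos; rewrite /x; lra.
  have ci := cos2Dsin2 (theta i); have cj := cos2Dsin2 (theta j).
  have cx := cos2Dsin2 x.
  transitivity (rho ^+ 2 * ((cos (theta i) - cos (theta j)) ^+ 2 +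
                            (sin (theta i) - sin (theta j)) ^+ 2)).
    rewrite !qE !dotv_lin (dotvC v u) (dotvC u c) (dotvC v c) uu vv uv; ring.
  rewrite /hs -/x 2!exprMn [RHS]mulrAC mulrC; congr (_ * _); lra.
by rewrite sqrtr_sqr normrM gtr0_norm // mulr_gt0.
Qed.

(* The balance equation at body [i] is projected on the radial direction bisecting
   bodies [i] and [l], which is orthogonal to the chord joining them. *)
Lemma balance_circle L i l :
  \sum_(j < 4) (m j * ((rdist q i j ^+ 3)^-1 - L)) *: (q j - q i) = 0 ->
  \sum_(j < 4) m j * ((rdist q i j ^+ 3)^-1 - L) * (hs i j * hs l j) = 0.
Proof.
pose b := (theta i + theta l) / 2.
move=> /(congr1 (dotv (cos b *: u + sin b *: v))); rewrite dotv_sumr dotv0r => eq0.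
have k0 : - (2 * rho) != 0 by rewrite oppr_eq0 gt_eqF // mulr_gt0.
apply: (mulfI k0); rewrite mulr0 mulr_sumr -[RHS]eq0; apply: eq_bigr => j _.
rewrite dotvZr mulrCA; congr (_ * _).
have -> : dotv (cos b *: u + sin b *: v) (q j - q i) =
    rho * (cos (theta j - b) - cos (theta i - b)).
  by rewrite !qE !dotv_lin (dotvC v u) uu vv uv !cosB; ring.
pose x := (theta j - theta i) / 2; pose y := (theta j - theta l) / 2.
have -> : theta j - b = x + y by rewrite /b /x /y; lra.
have -> : theta i - b = y - x by rewrite /b /x /y; lra.
by rewrite /hs -/x -/y cosD cosB; ring.
Qed.

Hypotheses (t01 : theta 0 < theta 1) (t12 : theta 1 < theta 2)
  (t23 : theta 2 < theta 3) (t30 : theta 3 < theta 0 + 2 * pi).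

(** The projected balance equations determine the six pair coefficients [A i j] up to one common
    factor [mu], each being proportional to the opposite chord. Ptolemy then fixes the sign of
    [mu]. *)
Lemma circle_ptolemy_critical : central_config m q ->
  exists L mu, 0 < L /\ ptolemy_critical (fun i j => m i * m j) (rdist q) L mu.
Proof.
move=> /(central_config_balance m_gt0)[L bal].
have hs_gt0 i j : theta i < theta j -> theta j < theta i + 2 * pi -> 0 < hs i j.
  by move=> ij ji; apply: sin_gt0_pi; apply/andP; split; lra.
have t02 := lt_trans t01 t12; have t13 := lt_trans t12 t23.
have t03 := lt_trans t02 t23; have t20 := lt_trans t23 t30.
have t10 := lt_trans t12 t20.
have up i j : theta i < theta j -> theta j + 2 * pi > theta i + 2 * pi by rewrite ltrD2r.
have s01 : 0 < hs 0 1 := hs_gt0 _ _ t01 t10.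
have s02 : 0 < hs 0 2 := hs_gt0 _ _ t02 t20.
have s03 : 0 < hs 0 3 := hs_gt0 _ _ t03 t30.
have s12 : 0 < hs 1 2 := hs_gt0 _ _ t12 (lt_trans t20 (up _ _ t01)).
have s13 : 0 < hs 1 3 := hs_gt0 _ _ t13 (lt_trans t30 (up _ _ t01)).
have s23 : 0 < hs 2 3 := hs_gt0 _ _ t23 (lt_trans t30 (up _ _ t02)).
have rsym i j : rdist q i j = rdist q j i.
  by rewrite !rdist_circle (hsN i j) normrN.
have rE i j : 0 < hs i j -> rdist q i j = 2 * rho * hs i j.
  by move=> ij; rewrite rdist_circle gtr0_norm.
have rpos : forall i j, i != j -> 0 < rdist q i j.
  have aux i j : 0 < hs i j -> 0 < rdist q i j by move=> ij; rewrite rE // !mulr_gt0.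
  by apply: forall_ord4; apply: forall_ord4 => // _;
     first [exact: aux | rewrite rsym; exact: aux].
have pto : rdist q 0 2 * rdist q 1 3 =
    rdist q 0 1 * rdist q 2 3 + rdist q 0 3 * rdist q 1 2.
  by rewrite !rE // /hs !mulrBl !sinB; ring.
pose A i j := m i * m j * ((rdist q i j ^+ 3)^-1 - L) * hs i j.
have AN i j : A j i = - A i j by rewrite /A rsym (hsN i j); ring.
have balA i l : \sum_(j < 4) A i j * hs l j = 0.
  have /(congr1 ( *%R (m i))) := balance_circle l (bal i).
  rewrite mulr0 mulr_sumr => bal_il; rewrite -[RHS]bal_il.
  by apply: eq_bigr => j _; rewrite /A; ring.
have A0 i : A i i = 0 by rewrite /A hs0 mulr0.
(* In [balA i l] the terms [j = i] and [j = l] vanish, so each instance relates just two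
   coefficients and all six follow from [A 0 1]. *)
have b03 := balA 0 3; have b02 := balA 0 2; have b10 := balA 1 0.
have b12 := balA 1 2; have b21 := balA 2 1.
rewrite sum_ord4 !(A0, hs0) (hsN 1 3) (hsN 2 3) in b03.
rewrite sum_ord4 !(A0, hs0) (hsN 1 2) in b02.
rewrite sum_ord4 !(A0, hs0) in b10.
rewrite sum_ord4 !(A0, hs0) (hsN 0 2) (AN 0 1) in b12.
rewrite sum_ord4 !(A0, hs0) (hsN 0 1) (AN 0 2) in b21.
pose mu := A 0 1 / hs 2 3.
have A01 : A 0 1 = mu * hs 2 3 by rewrite /mu divfK ?gt_eqF.
have A02 : A 0 2 = - (mu * hs 1 3).
  by apply: (mulIf (lt0r_neq0 s23)); rewrite A01 in b03; lra.
have A03 : A 0 3 = mu * hs 1 2.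
  by apply: (mulIf (lt0r_neq0 s23)); rewrite A01 in b02; lra.
have A13 : A 1 3 = - (mu * hs 0 2).
  by apply: (mulIf (lt0r_neq0 s23)); rewrite A01 in b12; lra.
have A12 : A 1 2 = mu * hs 0 3.
  by apply: (mulIf (lt0r_neq0 s02)); rewrite A13 in b10; lra.
have A23 : A 2 3 = mu * hs 0 1.
  by apply: (mulIf (lt0r_neq0 s13)); rewrite A02 in b21; lra.
have sgA i j : 0 < hs i j -> (0 < A i j) = (L < (rdist q i j ^+ 3)^-1).
  by move=> ij; rewrite /A pmulr_lgt0 // pmulr_rgt0 ?mulr_gt0 // subr_gt0.
have sgA' i j : 0 < hs i j -> (A i j < 0) = ((rdist q i j ^+ 3)^-1 < L).
  by move=> ij; rewrite /A pmulr_llt0 // pmulr_rlt0 ?mulr_gt0 // subr_lt0.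
(* If [mu <= 0], the diagonals are no longer than the sides: [r_02 <= r_01] and [r_13 <= r_23]. Then
   [r_02 r_13 <= r_01 r_23], against Ptolemy with [r_03 r_12 > 0]. *)
have mu0 : 0 < mu.
  rewrite ltNge; apply/negP => mu0.
  have rle i j k l : i != j -> k != l -> 0 < hs i j -> 0 < hs k l ->
      A i j <= 0 -> 0 <= A k l -> rdist q k l <= rdist q i j.
    move=> ij kl hij hkl; rewrite leNgt sgA // -leNgt => lij.
    rewrite leNgt sgA' // -leNgt => lkl.
    have := le_trans lij lkl; rewrite lef_pV2 ?posrE ?exprn_gt0 ?rpos //.
    by rewrite ler_pXn2r // nnegrE ltW ?rpos.
  have le1 : rdist q 0 2 <= rdist q 0 1.
    by apply: rle => //; rewrite ?A01 ?A02 ?oppr_ge0 mulr_le0_ge0 // ltW.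
  have le2 : rdist q 1 3 <= rdist q 2 3.
    by apply: rle => //; rewrite ?A13 ?A23 ?oppr_ge0 mulr_le0_ge0 // ltW.
  have := ler_pM (ltW (rpos 0 2 isT)) (ltW (rpos 1 3 isT)) le1 le2.
  have := mulr_gt0 (rpos 0 3 isT) (rpos 1 2 isT).
  by rewrite pto; lra.
have L0 : 0 < L.
  apply: (@lt_trans _ _ (rdist q 0 2 ^+ 3)^-1); first by rewrite invr_gt0 exprn_gt0 ?rpos.
  by rewrite -sgA' // A02 oppr_lt0 mulr_gt0.
(* Multiply [A i j] by [- r_ij ^+ 2] and divide by [hs i j = r_ij / (2 * rho)]. When [k] is [mu]
   times the opposite chord up to sign, [2 * rho] converts that chord into a distance. *)
have eqA i j k : 0 < hs i j -> i != j -> A i j = k ->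
    m i * m j * (L * rdist q i j ^+ 2 - (rdist q i j)^-1) = - (rdist q i j * (2 * rho * k)).
  move=> hij ij <-; rewrite /A; have := gt_eqF (rpos _ _ ij).
  rewrite !rE // => /negbT r0; field.
  by move: r0; rewrite mulf_eq0 negb_or => /andP[_ ->]; rewrite gt_eqF.
exists L, mu; split=> //; split=> //; first exact: ltW.
- by rewrite (eqA _ _ _ s01 isT A01) !rE //; ring.
- by rewrite (eqA _ _ _ s23 isT A23) !rE //; ring.
- by rewrite (eqA _ _ _ s03 isT A03) !rE //; ring.
- by rewrite (eqA _ _ _ s12 isT A12) !rE //; ring.
- by rewrite (eqA _ _ _ s02 isT A02) !rE //; ring.
- by rewrite (eqA _ _ _ s13 isT A13) !rE //; ring.
Qed.
End Circle.

(** * Relabelling, rescaling and reconstruction from distances *)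

Lemma central_config_perm (R : realType) (d : nat) (m : 'I_4 -> R)
    (q : 'I_4 -> 'cV[R]_d) (s : {perm 'I_4}) :
  central_config m q -> central_config (m \o s) (q \o s).
Proof.
case=> q_inj com [lambda eqL]; split; first exact: inj_comp q_inj perm_inj.
  have sum_s (V : nmodType) (F : 'I_4 -> V) : \sum_i F (s i) = \sum_i F i.
    by rewrite [RHS](reindex_inj (@perm_inj _ s)).
  by rewrite /com_zero /= (sum_s _ m) (sum_s _ (fun i => m i *: q i)).
exists lambda => i /=; rewrite eqL (reindex_inj (@perm_inj _ s)) /=.
by apply: eq_bigl => j; rewrite (inj_eq perm_inj).
Qed.

Lemma ptolemy_critical_scale (R : realType) (w r : 'I_4 -> 'I_4 -> R) (L mu k : R) :
  0 < k -> ptolemy_critical w r L mu ->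
  ptolemy_critical w (fun i j => k * r i j) (L / k ^+ 3) (mu / k ^+ 3).
Proof.
move=> k0 [rp mu0 pt e01 e23 e03 e12 e02 e13].
have eqk i j : i != j -> w i j * (L / k ^+ 3 * (k * r i j) ^+ 2 - (k * r i j)^-1) =
    (w i j * (L * r i j ^+ 2 - (r i j)^-1)) / k.
  by move=> ij; field; rewrite (lt0r_neq0 k0) lt0r_neq0 ?rp.
split; rewrite ?eqk ?e01 ?e23 ?e03 ?e12 ?e02 ?e13 //.
- by move=> i j ij; rewrite mulr_gt0 ?rp.
- by rewrite divr_ge0 // exprn_ge0 // ltW.
- by rewrite mulrACA pt; ring.
all: by field; rewrite lt0r_neq0.
Qed.

Lemma rdist_sqr (R : realType) (d : nat) (q : 'I_4 -> 'cV[R]_d) i j :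
  rdist q i j ^+ 2 = dotv (q i) (q i) + dotv (q j) (q j) - 2 * dotv (q i) (q j).
Proof.
by rewrite sqr_sqrtr ?dotvv_ge0 // !dotv_lin (dotvC (q j) (q i)); ring.
Qed.

(** Let [D] be the difference of the Gram matrices. Equal distances give
    [D i i + D j j = 2 * D i j], and centring makes the mass-weighted row sums of [D] vanish;
    together these force the diagonal, then all of [D], to be zero. *)
Lemma rdist_gram (R : realType) (d : nat) (m : 'I_4 -> R) (x y : 'I_4 -> 'cV[R]_d) :
  (forall i, 0 < m i) ->
  \sum_(i < 4) m i *: x i = 0 -> \sum_(i < 4) m i *: y i = 0 ->
  rdist x =2 rdist y ->
  forall i j, dotv (x i) (x j) = dotv (y i) (y j).
Proof.
move=> m0 cx cy xy.
pose D i j := dotv (x i) (x j) - dotv (y i) (y j).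
have D2 i j : D i i + D j j = 2 * D i j.
  by have := rdist_sqr x i j; rewrite xy rdist_sqr /D; lra.
have mD i : \sum_j m j * D i j = 0.
  have sum0 (p : 'I_4 -> 'cV[R]_d) : \sum_j m j *: p j = 0 ->
      \sum_j m j * dotv (p i) (p j) = 0.
    move=> cp; rewrite -[RHS](dotv0r (p i)) -[X in dotv _ X]cp dotv_sumr.
    by apply: eq_bigr => j _; rewrite dotvZr.
  rewrite -[RHS](subrr 0) -[X in _ = X - _](sum0 x cx) -[X in _ = _ - X](sum0 y cy).
  by rewrite -sumrB; apply: eq_bigr => j _; rewrite mulrBr.
pose M := \sum_i m i; pose N := \sum_j m j * D j j.
have M0 : 0 < M by rewrite /M sum_ord4 !addr_gt0.
have DN i : M * D i i + N = 0.
  rewrite /M mulr_suml -big_split /= -[RHS](mulr0 2) -[X in _ = _ * X](mD i) mulr_sumr.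
  by apply: eq_bigr => j _; rewrite -mulrDr D2 mulrCA.
(* The mass-weighted sum of the relations [DN] is [2 * M * N]. *)
have N0 : N = 0.
  have : \sum_i m i * (M * D i i + N) = 0 by rewrite big1 // => i _; rewrite DN mulr0.
  under eq_bigr do rewrite mulrDr mulrCA.
  rewrite big_split /= -mulr_sumr -mulr_suml -/N -/M -mulr2n => /eqP.
  by rewrite mulrn_eq0 mulf_eq0 (gt_eqF M0) => /eqP.
have D0 i : D i i = 0.
  by have /eqP := DN i; rewrite N0 addr0 mulf_eq0 (gt_eqF M0) => /eqP.
move=> i j; apply/eqP; rewrite -subr_eq0 -/(D i j).
by have /esym/eqP := D2 i j; rewrite !D0 addr0 mulf_eq0 pnatr_eq0.
Qed.

Lemma rdist_equiv_config (R : realType) (d : nat) (m : 'I_4 -> R)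
    (q q' : 'I_4 -> 'cV[R]_d) (k : R) :
  (forall i, 0 < m i) -> com_zero m q -> com_zero m q' -> 0 < k ->
  (forall i j, rdist q' i j = k * rdist q i j) -> equiv_config q q'.
Proof.
move=> m0 cq cq' k0 qq'.
have com p : com_zero m p -> \sum_(i < 4) m i *: p i = 0.
  move=> /eqP; rewrite scaler_eq0 invr_eq0 gt_eqF /= => [/eqP //|].
  by rewrite sum_ord4 !addr_gt0.
have gram : forall i j, dotv (k *: q i) (k *: q j) = dotv (q' i) (q' j).
  apply: (@rdist_gram _ _ m (fun i => k *: q i)) => //; last 2 first.
  - exact: com.
  - move=> i j; rewrite qq' /rdist /normv -scalerBr dotvZl dotvZr mulrA -expr2.
    by rewrite sqrtrM ?sqr_ge0 // sqrtr_sqr gtr0_norm.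
  under eq_bigr do rewrite scalerA mulrC -scalerA.
  by rewrite -scaler_sumr com // scaler0.
have [i j _ _|A oA Aq] := @isometry_extension _ _ 4
    (fun i => k *: q (inord i)) (fun i => q' (inord i)); first exact: gram.
exists k, A; split; [exact: lt0r_neq0 | split => // i].
by have := Aq i (ltn_ord i); rewrite inord_val -scalemxAr.
Qed.

Set Strict Implicit. Unset Implicit Arguments.

Theorem theorem1 (R : realType) (d : nat) (m : 'I_4 -> R)
    (hm : forall i, 0 < m i) (s : {perm 'I_4}) (q q' : 'I_4 -> 'cV[R]_d) :
  central_config m q -> central_config m q' ->
  cocircular_with_order q s -> cocircular_with_order q' s ->
  equiv_config q q'.
Proof.
move=> cc cc' [c [u [v [rho [th [[rho0 uu vv uv] [qE [t01 t12 t23 t30]]]]]]]].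
move=> [c' [u' [v' [rho' [th' [[rho'0 uu' vv' uv'] [q'E [t01' t12' t23' t30']]]]]]]].
(* Relabelling by [s] puts both configurations in the cyclic order 0, 1, 2, 3. *)
have ms0 i : 0 < (m \o s) i by exact: hm.
have [L [mu [L0 crit]]] := circle_ptolemy_critical ms0 rho0 uu vv uv
  (fun i => qE (s i)) t01 t12 t23 t30 (central_config_perm s cc).
have [L' [mu' [L'0 crit']]] := circle_ptolemy_critical ms0 rho'0 uu' vv' uv'
  (fun i => q'E (s i)) t01' t12' t23' t30' (central_config_perm s cc').
(* The cube root of [L / L']: scaling lengths by [k] divides [L] by [k ^+ 3], so both configurations
   become critical for the same [L']. *)
pose k := expR (ln (L / L') / 3).
have k0 : 0 < k by exact: expR_gt0.
have LL' : L / k ^+ 3 = L'.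
  rewrite /k -expRM_natl [3 * _]mulrC divfK ?pnatr_eq0 // lnK ?posrE ?divr_gt0 //.
  by rewrite invf_div mulrC divfK ?gt_eqF.
have := ptolemy_critical_scale k0 crit; rewrite LL' => critk.
have rdistC (p : 'I_4 -> 'cV[R]_d) i j : rdist p i j = rdist p j i.
  by rewrite /rdist /normv -opprB dotvNl dotvNr opprK.
have rdist0 (p : 'I_4 -> 'cV[R]_d) i : rdist p i i = 0.
  by rewrite /rdist /normv subrr dotv0r sqrtr0.
have rr' : forall i j, rdist (q' \o s) i j = k * rdist (q \o s) i j.
  apply: (ptolemy_critical_uniq L'0 _ _ _ _ crit' critk) => [i j|i|i j|i j].
  - exact: mulr_gt0.
  - by rewrite !rdist0 mulr0.
  - exact: rdistC.
  - by rewrite rdistC.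
have [_ com _] := cc; have [_ com' _] := cc'.
apply: (rdist_equiv_config hm com com' k0) => i j.
by have := rr' (s^-1 i)%g (s^-1 j)%g; rewrite /rdist /= !permKV.
Qed.
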